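(* Let $R$ be a commutative ring, let $\Lambda$ be an $R$-algebra, and let $S$ be a commutative faithfully flat $R$-algebra. Let $X$ and $Y$ be objects of $D(\Lambda)$ and let $\alpha\in \mathrm{Hom}_{D(\Lambda)}(X,Y)$. If $$\mathrm{id}_S\otimes_R^{\mathbb L}\alpha\in \mathrm{Hom}_{D(S\otimes_R\Lambda)}(S\otimes_R^{\mathbb L}X,\,S\otimes_R^{\mathbb L}Y)$$ is an isomorphism in $D(S\otimes_R\Lambda)$, then $\alpha$ is an isomorphism in $D(\Lambda)$.
   Context: For a ring $A$, $D(A)$ denotes the derived category of complexes of finitely generated $A$-modules, that is, the localisation of the homotopy category of complexes of finitely generated $A$-modules at the quasi-isomorphisms (homology being computed in the category of all $A$-modules). Since $S$ is flat over $R$, the functor $S\otimes_R^{\mathbb L}-$ is given by the ordinary tensor product $S\otimes_R-$ applied degreewise to complexes; it sends complexes of finitely generated $\Lambda$-modules to complexes of finitely generated $S\otimes_R\Lambda$-modules. *)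

(* Defs.v *)
From HB Require Import structures.
From mathcomp Require Import all_boot all_algebra.
From mathcomp Require Import boolp.

Set Implicit Arguments.
Unset Strict Implicit.
Unset Printing Implicit Defensive.

Import GRing.Theory.
Local Open Scope ring_scope.
Local Open Scope quotient_scope.

(* Associative unital algebras over a commutative ring, given by a ring
   morphism into the centre. The library's algType is not used because it
   excludes the zero algebra. *)
HB.mixin Record isCentralAlgebra (R : comPzRingType) (A : Type)
    of GRing.PzRing A := {
  algmap : {rmorphism R -> A};
  algmapC : forall (r : R) (a : A), algmap r * a = a * algmap r
}.
#[short(type="pzAlgType")]
HB.structure Definition PzAlgebra (R : comPzRingType) :=
  {A of isCentralAlgebra R A & GRing.PzRing A}.
#[short(type="comPzAlgType")]
HB.structure Definition ComPzAlgebra (R : comPzRingType) :=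
  {A of isCentralAlgebra R A & GRing.ComPzRing A}.

Section Restriction.
Variables (R : comPzRingType) (A : pzAlgType R).

(* An A-module, seen as an R-module along the structure map. *)
Definition restr (M : lmodType A) : Type := M.

Section Module.
Variable M : lmodType A.
HB.instance Definition _ := GRing.Zmodule.on (restr M).

Definition restr_scale (r : R) (m : restr M) : restr M :=
  (algmap r : A) *: (m : M).

Fact restr_scaleA a b v :
  restr_scale a (restr_scale b v) = restr_scale (a * b) v.
Proof. by rewrite /restr_scale scalerA rmorphM. Qed.
Fact restr_scale1 : left_id 1 restr_scale.
Proof. by move=> v; rewrite /restr_scale rmorph1 scale1r. Qed.
Fact restr_scaleDr : right_distributive restr_scale +%R.
Proof. by move=> a u v; rewrite /restr_scale scalerDr. Qed.
Fact restr_scaleDl v : {morph restr_scale^~ v : a b / a + b}.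
Proof. by move=> a b; rewrite /restr_scale rmorphD scalerDl. Qed.
HB.instance Definition _ := GRing.Zmodule_isLmodule.Build R (restr M)
  restr_scaleA restr_scale1 restr_scaleDr restr_scaleDl.

Lemma restr_scaleE (r : R) (m : restr M) :
  r *: m = ((algmap r : A) *: (m : M)).
Proof. by []. Qed.
End Module.

Definition restr_map (M N : lmodType A) (f : M -> N) : restr M -> restr N := f.

Fact restr_map_linear (M N : lmodType A) (f : {linear M -> N}) :
  linear (restr_map f).
Proof. by move=> a u v; rewrite /restr_map /= linearD linearZ. Qed.
HB.instance Definition _ (M N : lmodType A) (f : {linear M -> N}) :=
  GRing.isLinear.Build R (restr M) (restr N) *:%R (restr_map f)
    (restr_map_linear f).

End Restriction.
Arguments restr {R A} M.

Section Tensor.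
Variables (R : comPzRingType) (M N : lmodType R).

(* A word [:: (m1, n1); ...; (mk, nk)] stands for the sum of the mi (x) ni. *)
Inductive tensor_rel : seq (M * N) -> seq (M * N) -> Prop :=
| tr_refl w : tensor_rel w w
| tr_sym w w' : tensor_rel w w' -> tensor_rel w' w
| tr_trans w1 w2 w3 :
    tensor_rel w1 w2 -> tensor_rel w2 w3 -> tensor_rel w1 w3
| tr_cat w1 w1' w2 w2' :
    tensor_rel w1 w1' -> tensor_rel w2 w2' ->
    tensor_rel (w1 ++ w2) (w1' ++ w2')
| tr_catC w1 w2 : tensor_rel (w1 ++ w2) (w2 ++ w1)
| tr_addl m m' n : tensor_rel [:: (m + m', n)] [:: (m, n); (m', n)]
| tr_addr m n n' : tensor_rel [:: (m, n + n')] [:: (m, n); (m, n')]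
| tr_scale a m n : tensor_rel [:: (a *: m, n)] [:: (m, a *: n)]
| tr_zero n : tensor_rel [:: (0, n)] [::].

Definition tensor_relb (w w' : seq (M * N)) : bool := `[< tensor_rel w w' >].

Fact tensor_relb_equiv : equiv_class_of tensor_relb.
Proof.
split=> [w|w w'|w1 w2 w3]; rewrite /tensor_relb.
- by apply/asboolP; apply: tr_refl.
- by apply/asboolP/asboolP; apply: tr_sym.
- by move=> /asboolP h /asboolP h'; apply/asboolP; apply: tr_trans h h'.
Qed.
Canonical tensor_equiv := EquivRelPack tensor_relb_equiv.

Definition tensor : Type := {eq_quot tensor_relb}.
HB.instance Definition _ := Choice.on tensor.
HB.instance Definition _ := EqQuotient.on tensor.

Lemma tensor_piP w w' : \pi_tensor w = \pi_tensor w' <-> tensor_rel w w'.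
Proof.
split=> [h|h]; last by apply/eqP; rewrite piE; apply/asboolP.
by apply/asboolP; move/eqP: h; rewrite piE.
Qed.

Lemma tensor_repr w : tensor_rel (repr (\pi_tensor w)) w.
Proof. by apply/tensor_piP; rewrite reprK. Qed.

Let zero : tensor := \pi_tensor [::].
Let add (t u : tensor) : tensor := \pi_tensor (repr t ++ repr u).
Let oppw (w : seq (M * N)) := [seq (- p.1, p.2) | p <- w].
Let opp (t : tensor) : tensor := \pi_tensor (oppw (repr t)).

Let addE w w' : add (\pi_tensor w) (\pi_tensor w') = \pi_tensor (w ++ w').
Proof. by apply/tensor_piP; apply: tr_cat; apply: tensor_repr. Qed.

Let oppwN w : tensor_rel (oppw w ++ w) [::].
Proof.
elim: w => [|[m n] w IH]; first exact: tr_refl.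
apply: (@tr_trans _ ([:: (- m, n); (m, n)] ++ (oppw w ++ w))).
  have -> : oppw ((m, n) :: w) ++ (m, n) :: w =
      [:: (- m, n)] ++ ((oppw w ++ [:: (m, n)]) ++ w) by rewrite -catA.
  rewrite -[X in tensor_rel _ X]/([:: (- m, n)] ++ (([:: (m, n)] ++ oppw w) ++ w)).
  apply: tr_cat; first exact: tr_refl.
  by apply: tr_cat; [exact: tr_catC|exact: tr_refl].
apply: (tr_cat (w1' := [::]) (w2' := [::])) => //.
apply: (@tr_trans _ [:: (- m + m, n)]); first by apply: tr_sym; apply: tr_addl.
by rewrite addNr; apply: tr_zero.
Qed.

Let tensorW t : exists w, t = \pi_tensor w.
Proof. by exists (repr t); rewrite reprK. Qed.

Let addA : associative add.
Proof.
move=> t u v; have [w1 ->] := tensorW t; have [w2 ->] := tensorW u.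
have [w3 ->] := tensorW v.
by rewrite !addE catA.
Qed.
Let addC : commutative add.
Proof.
move=> t u; have [w1 ->] := tensorW t; have [w2 ->] := tensorW u.
by rewrite !addE; apply/tensor_piP/tr_catC.
Qed.
Let add0 : left_id zero add.
Proof. by move=> t; have [w ->] := tensorW t; rewrite addE. Qed.
Let addN : left_inverse zero opp add.
Proof.
move=> t; rewrite -{2}[t]reprK /opp addE; apply/tensor_piP; exact: oppwN.
Qed.
HB.instance Definition _ := GRing.isZmodule.Build tensor addA addC add0 addN.

Definition tens (m : M) (n : N) : tensor := \pi_tensor [:: (m, n)].

Lemma tensDl m m' n : tens (m + m') n = tens m n + tens m' n.
Proof. by rewrite [RHS]addE; apply/tensor_piP/tr_addl. Qed.
Lemma tensDr m n n' : tens m (n + n') = tens m n + tens m n'.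
Proof. by rewrite [RHS]addE; apply/tensor_piP/tr_addr. Qed.
Lemma tensZ a m n : tens (a *: m) n = tens m (a *: n).
Proof. by apply/tensor_piP/tr_scale. Qed.

Lemma tens0r m : tens m 0 = 0.
Proof. by apply: (addIr (tens m 0)); rewrite -tensDr !add0r. Qed.

Lemma tensNr m n : tens m (- n) = - tens m n.
Proof. by apply/eqP; rewrite -addr_eq0 -tensDr addNr tens0r. Qed.

Lemma tensor_piE w : \pi_tensor w = \sum_(p <- w) tens p.1 p.2.
Proof.
elim: w => [|[m n] w IH]; first by rewrite big_nil.
by rewrite big_cons -IH [RHS]addE.
Qed.

Lemma tensor_ind (P : tensor -> Prop) :
  P 0 -> (forall t u, P t -> P u -> P (t + u)) ->
  (forall m n, P (tens m n)) -> forall t, P t.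
Proof.
move=> P0 PD Pt t; have [w ->] := tensorW t; rewrite tensor_piE.
by elim: w => [|p w IH]; rewrite ?big_nil // big_cons; apply: PD.
Qed.

Section Lift.
Variable V : zmodType.

Record balanced (f : M -> N -> V) : Prop := Balanced {
  balancedDl : forall m m' n, f (m + m') n = f m n + f m' n;
  balancedDr : forall m n n', f m (n + n') = f m n + f m n';
  balancedZ : forall a m n, f (a *: m) n = f m (a *: n)
}.

(* The additive map out of the tensor product; meaningful for balanced f. *)
Definition tensor_lift (f : M -> N -> V) (t : tensor) : V :=
  \sum_(p <- repr t) f p.1 p.2.

Lemma tensor_lift_rel f w w' : balanced f -> tensor_rel w w' ->
  \sum_(p <- w) f p.1 p.2 = \sum_(p <- w') f p.1 p.2.
Proof.
move=> [fDl fDr fZ]; elim=> {w w'} //.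
- by move=> w1 w2 w3 _ -> _ ->.
- by move=> w1 w1' w2 w2' _ h1 _ h2; rewrite !big_cat /= h1 h2.
- by move=> w1 w2; rewrite !big_cat /= addrC.
- by move=> m m' n; rewrite !big_cons !big_nil /= fDl !addr0.
- by move=> m n n'; rewrite !big_cons !big_nil /= fDr !addr0.
- by move=> a m n; rewrite !big_cons !big_nil /= fZ.
- move=> n; rewrite big_cons !big_nil /= addr0.
  by apply: (addIr (f 0 n)); rewrite -fDl !add0r.
Qed.

Lemma tensor_lift_pi f w : balanced f ->
  tensor_lift f (\pi_tensor w) = \sum_(p <- w) f p.1 p.2.
Proof. by move=> fb; apply: tensor_lift_rel (tensor_repr w). Qed.

Lemma tensor_lift_tens f m n : balanced f -> tensor_lift f (tens m n) = f m n.
Proof. by move=> fb; rewrite tensor_lift_pi // big_seq1. Qed.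

Lemma tensor_liftD f t u : balanced f ->
  tensor_lift f (t + u) = tensor_lift f t + tensor_lift f u.
Proof.
move=> fb; have [w ->] := tensorW t; have [w' ->] := tensorW u.
rewrite [X in tensor_lift f X]addE.
by rewrite !tensor_lift_pi // big_cat.
Qed.

Lemma tensor_lift0 f : balanced f -> tensor_lift f 0 = 0.
Proof. by move=> fb; apply: (addIr (tensor_lift f 0)); rewrite -tensor_liftD // !add0r. Qed.

End Lift.
End Tensor.

Section TensorMap.
Variables (R : comPzRingType) (S : lmodType R).

Definition tensor_map (M N : lmodType R) (f : M -> N) :
    tensor S M -> tensor S N :=
  tensor_lift (fun s m => tens s (f m)).

Lemma tensor_map_balanced (M N : lmodType R) (f : {linear M -> N}) :
  balanced (fun (s : S) m => tens s (f m)).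
Proof.
split=> [s s' m|s m m'|a s m]; first exact: tensDl.
- by rewrite linearD tensDr.
- by rewrite linearZ tensZ.
Qed.

Lemma tensor_map_tens (M N : lmodType R) (f : {linear M -> N}) s m :
  tensor_map f (tens s m) = tens s (f m).
Proof. exact: tensor_lift_tens (tensor_map_balanced f). Qed.

Lemma tensor_mapD (M N : lmodType R) (f : {linear M -> N}) t u :
  tensor_map f (t + u) = tensor_map f t + tensor_map f u.
Proof. exact: tensor_liftD (tensor_map_balanced f). Qed.

Lemma tensor_map0 (M N : lmodType R) (f : {linear M -> N}) :
  tensor_map f 0 = 0.
Proof. exact: tensor_lift0 (tensor_map_balanced f). Qed.

Lemma tensor_mapN (M N : lmodType R) (f : {linear M -> N}) t :
  tensor_map f (- t) = - tensor_map f t.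
Proof.
by apply/eqP; rewrite -addr_eq0 -tensor_mapD addNr tensor_map0.
Qed.

Lemma tensor_map_comp (M N P : lmodType R) (f : {linear M -> N})
  (g : {linear N -> P}) (h : {linear M -> P}) t :
  (forall m, h m = g (f m)) -> tensor_map h t = tensor_map g (tensor_map f t).
Proof.
move=> hE; elim/tensor_ind: t => [|t u IHt IHu|s m].
- by rewrite !tensor_map0.
- by rewrite !tensor_mapD IHt IHu.
- by rewrite !tensor_map_tens hE.
Qed.

Lemma tensor_map_id (M : lmodType R) (f : {linear M -> M}) t :
  (forall m, f m = m) -> tensor_map f t = t.
Proof.
move=> fE; elim/tensor_ind: t => [|t u IHt IHu|s m].
- by rewrite !tensor_map0.
- by rewrite !tensor_mapD IHt IHu.
- by rewrite !tensor_map_tens fE.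
Qed.

Lemma tensor_map_eq0 (M N : lmodType R) (f : {linear M -> N}) t :
  (forall m, f m = 0) -> tensor_map f t = 0.
Proof.
move=> fE; elim/tensor_ind: t => [|t u IHt IHu|s m].
- by rewrite !tensor_map0.
- by rewrite !tensor_mapD IHt IHu addr0.
- by rewrite !tensor_map_tens fE tens0r.
Qed.

Lemma tensor_map_add (M N : lmodType R) (f g h : {linear M -> N}) t :
  (forall m, h m = f m + g m) ->
  tensor_map h t = tensor_map f t + tensor_map g t.
Proof.
move=> hE; elim/tensor_ind: t => [|t u IHt IHu|s m].
- by rewrite !tensor_map0 addr0.
- by rewrite !tensor_mapD IHt IHu addrACA.
- by rewrite !tensor_map_tens hE tensDr.
Qed.

End TensorMap.
Arguments tensor_map {R} S {M N} f.

Section TensorProduct.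
Variables (R : comPzRingType) (S M N : lmodType R).

Definition inl_lin (m : M) : (M * N)%type := (m, 0).
Definition inr_lin (n : N) : (M * N)%type := (0, n).

Fact inl_linear : linear inl_lin.
Proof. by move=> a m m'; congr pair; rewrite /= scaler0 addr0. Qed.
HB.instance Definition _ := GRing.isLinear.Build R M (M * N)%type *:%R inl_lin inl_linear.
Fact inr_linear : linear inr_lin.
Proof. by move=> a n n'; congr pair; rewrite /= scaler0 addr0. Qed.
HB.instance Definition _ := GRing.isLinear.Build R N (M * N)%type *:%R inr_lin inr_linear.

Definition tens_pair (x : tensor S M) (y : tensor S N) : tensor S (M * N)%type :=
  tensor_map S inl_lin x + tensor_map S inr_lin y.

Lemma tens_pair_fst x y : tensor_map S fst (tens_pair x y) = x.
Proof.
rewrite /tens_pair tensor_mapD -(tensor_map_comp (h := idfun)) //.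
rewrite -(tensor_map_comp (h := \0)) // tensor_map_id //.
by rewrite tensor_map_eq0 // addr0.
Qed.

Lemma tens_pair_snd x y : tensor_map S snd (tens_pair x y) = y.
Proof.
rewrite /tens_pair tensor_mapD -(tensor_map_comp (h := \0)) //.
rewrite -(tensor_map_comp (h := idfun)) // tensor_map_eq0 //.
by rewrite tensor_map_id // add0r.
Qed.

Lemma tens_pair_eta p : p = tens_pair (tensor_map S fst p) (tensor_map S snd p).
Proof.
rewrite /tens_pair -(tensor_map_comp (h := inl_lin \o fst)) //.
rewrite -(tensor_map_comp (h := inr_lin \o snd)) //.
rewrite -(tensor_map_add (h := idfun)) ?tensor_map_id //.
by move=> [m n]; congr pair; rewrite /= (addr0, add0r).
Qed.

End TensorProduct.

Definition exact_at (U V W : zmodType) (f : U -> V) (g : V -> W) : Prop :=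
  forall v, g v = 0 <-> exists u, f u = v.

Section Flat.
Variables (R : comPzRingType) (S : lmodType R).

(* S (x)_R - preserves exact sequences *)
Definition flat : Prop :=
  forall (M1 M2 M3 : lmodType R) (f : {linear M1 -> M2}) (g : {linear M2 -> M3}),
    exact_at f g -> exact_at (tensor_map S f) (tensor_map S g).

(* S (x)_R - preserves and reflects exact sequences (Bourbaki, Commutative
   Algebra, I.3.1, definition 1) *)
Definition faithfully_flat : Prop :=
  forall (M1 M2 M3 : lmodType R) (f : {linear M1 -> M2}) (g : {linear M2 -> M3}),
    exact_at f g <-> exact_at (tensor_map S f) (tensor_map S g).

Lemma faithfully_flat_flat : faithfully_flat -> flat.
Proof. by move=> h M1 M2 M3 f g /h. Qed.

End Flat.

Section BaseChange.
Variables (R : comPzRingType) (S : comPzAlgType R) (L : pzAlgType R).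

Definition self_mod : lmodType R := restr (S^o).

(* S (x)_R M for a L-module M. The ring S (x)_R L is the case of the left
   regular module, with product (s (x) l) (s' (x) l') = s s' (x) l l', and it
   acts on S (x)_R M by (s (x) l) (s' (x) m) = s s' (x) l m. *)
Definition ext_mod (M : lmodType L) : Type := tensor self_mod (restr M).
Definition ext_alg : Type := ext_mod (L^o).

HB.instance Definition _ (M : lmodType L) := GRing.Zmodule.on (ext_mod M).
HB.instance Definition _ := GRing.Zmodule.on ext_alg.

Definition ext_tens (M : lmodType L) (s : S) (m : M) : ext_mod M :=
  tens (s : self_mod) (m : restr M).

Lemma ext_mod_ind (M : lmodType L) (P : ext_mod M -> Prop) :
  P 0 -> (forall t u, P t -> P u -> P (t + u)) ->
  (forall s m, P (ext_tens s m)) -> forall t, P t.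
Proof. exact: tensor_ind. Qed.

Lemma ext_tensDr (M : lmodType L) s (m m' : M) :
  ext_tens s (m + m') = ext_tens s m + ext_tens s m'.
Proof. exact: tensDr. Qed.

Lemma ext_tens0r (M : lmodType L) s : ext_tens s (0 : M) = 0.
Proof. exact: tens0r. Qed.

Section Action.
Variable M : lmodType L.

Definition ext_act1 (s : S) (l : L) : ext_mod M -> ext_mod M :=
  tensor_lift (fun (s' : self_mod) (m : restr M) =>
    ext_tens (s * s') (l *: (m : M))).

Definition ext_act (a : ext_alg) (t : ext_mod M) : ext_mod M :=
  tensor_lift (fun (s : self_mod) (l : restr (L^o)) => ext_act1 s l t) a.

Lemma ext_act1_balanced s l :
  balanced (fun (s' : self_mod) (m : restr M) =>
    ext_tens (s * s') (l *: (m : M))).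
Proof.
split=> [s1 s2 m|s1 m m'|a s1 m]; rewrite /ext_tens.
- by rewrite mulrDr -tensDl.
- by rewrite scalerDr -tensDr.
- have -> : s * (a *: s1) = a *: (s * s1 : self_mod) :> self_mod.
    by rewrite !restr_scaleE /GRing.scale /= mulrCA.
  by rewrite tensZ !restr_scaleE !scalerA algmapC.
Qed.

Lemma ext_act1_tens s l s' m :
  ext_act1 s l (ext_tens s' m) = ext_tens (s * s') (l *: m).
Proof. exact: tensor_lift_tens (ext_act1_balanced s l). Qed.

Lemma ext_act1D s l t u : ext_act1 s l (t + u) = ext_act1 s l t + ext_act1 s l u.
Proof. exact: tensor_liftD (ext_act1_balanced s l). Qed.

Lemma ext_act1_0 s l : ext_act1 s l 0 = 0.
Proof. exact: tensor_lift0 (ext_act1_balanced s l). Qed.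

Lemma ext_act_balanced t :
  balanced (fun (s : self_mod) (l : restr (L^o)) => ext_act1 s l t).
Proof.
split=> [s1 s2 l|s l l'|a s l]; elim/tensor_ind: t => [|t u IHt IHu|s' m].
- by rewrite !ext_act1_0 addr0.
- by rewrite !ext_act1D IHt IHu addrACA.
- by rewrite !ext_act1_tens mulrDl /ext_tens -tensDl.
- by rewrite !ext_act1_0 addr0.
- by rewrite !ext_act1D IHt IHu addrACA.
- by rewrite !ext_act1_tens scalerDl /ext_tens -tensDr.
- by rewrite !ext_act1_0.
- by rewrite !ext_act1D IHt IHu.
- rewrite !ext_act1_tens /ext_tens.
  have -> : (a *: s : self_mod) * s' = a *: (s * s' : self_mod) :> self_mod.
    by rewrite !restr_scaleE /GRing.scale /= mulrA.
  by rewrite tensZ !restr_scaleE !scalerA.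
Qed.

Lemma ext_act_tens s l t : ext_act (ext_tens s (l : L^o)) t = ext_act1 s l t.
Proof. exact: tensor_lift_tens (ext_act_balanced t). Qed.

Lemma ext_act_tens2 s l s' m :
  ext_act (ext_tens s (l : L^o)) (ext_tens s' m) = ext_tens (s * s') (l *: m).
Proof. by rewrite ext_act_tens ext_act1_tens. Qed.

Lemma ext_actDl t : {morph ext_act^~ t : a b / a + b}.
Proof. by move=> a b; apply: tensor_liftD (ext_act_balanced t). Qed.

Lemma ext_act0l t : ext_act 0 t = 0.
Proof. exact: tensor_lift0 (ext_act_balanced t). Qed.

Lemma ext_actDr : right_distributive ext_act +%R.
Proof.
move=> a t u; elim/tensor_ind: a => [|a b IHa IHb|s l].
- by rewrite !ext_act0l addr0.
- by rewrite !ext_actDl IHa IHb addrACA.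
- by rewrite !ext_act_tens ext_act1D.
Qed.

Lemma ext_act0r a : ext_act a 0 = 0.
Proof. by apply: (addIr (ext_act a 0)); rewrite -ext_actDr !add0r. Qed.

Lemma ext_act1r : left_id (ext_tens 1 (1 : L^o)) ext_act.
Proof.
elim/tensor_ind => [|t u IHt IHu|s m]; first by rewrite ext_act0r.
  by rewrite ext_actDr IHt IHu.
by rewrite ext_act_tens2 mul1r scale1r.
Qed.

End Action.

Lemma ext_actA (M : lmodType L) (a b : ext_alg) (t : ext_mod M) :
  ext_act a (ext_act b t) = ext_act (ext_act (M := L^o) a b) t.
Proof.
elim/tensor_ind: a => [|a a' IHa IHa'|s l]; first by rewrite !ext_act0l.
  by rewrite !ext_actDl IHa IHa'.
elim/tensor_ind: b => [|b b' IHb IHb'|s' l'].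
- by rewrite ext_act0r !ext_act0l ext_act0r.
- by rewrite ext_actDl !ext_actDr ext_actDl IHb IHb'.
elim/tensor_ind: t => [|t u IHt IHu|s'' m]; first by rewrite !ext_act0r.
  by rewrite !ext_actDr IHt IHu.
by rewrite !ext_act_tens2 mulrA scalerA.
Qed.

Let mul : ext_alg -> ext_alg -> ext_alg := ext_act (M := L^o).
Let one : ext_alg := ext_tens 1 (1 : L^o).

Let mulA : associative mul.
Proof. by move=> a b c; apply: ext_actA. Qed.
Let mul1 : left_id one mul.
Proof. exact: ext_act1r. Qed.
Let mulr1 : right_id one mul.
Proof.
elim/tensor_ind => [|t u IHt IHu|s m]; first exact: ext_act0l.
  by move: IHt IHu; rewrite /mul ext_actDl => -> ->.
by rewrite /mul ext_act_tens2 mulr1 /GRing.scale /= mulr1.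
Qed.
Let mulDl : left_distributive mul +%R.
Proof. by move=> a b c; apply: ext_actDl. Qed.
Let mulDr : right_distributive mul +%R.
Proof. exact: ext_actDr. Qed.
HB.instance Definition _ :=
  GRing.Zmodule_isPzRing.Build ext_alg mulA mul1 mulr1 mulDl mulDr.

HB.instance Definition _ (M : lmodType L) :=
  GRing.Zmodule_isLmodule.Build ext_alg (ext_mod M)
    (@ext_actA M) (@ext_act1r M) (@ext_actDr M) (@ext_actDl M).

Definition ext_map (M N : lmodType L) (f : M -> N) : ext_mod M -> ext_mod N :=
  tensor_map self_mod (restr_map f).

Lemma ext_map_tens (M N : lmodType L) (f : {linear M -> N}) s m :
  ext_map f (ext_tens s m) = ext_tens s (f m).
Proof. exact: (tensor_map_tens (restr_map f)). Qed.

Fact ext_map_linear (M N : lmodType L) (f : {linear M -> N}) :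
  linear (ext_map f).
Proof.
move=> a t u; rewrite [LHS](tensor_mapD (restr_map f)); congr (_ + _).
rewrite -/(ext_map f _) /GRing.scale /=.
elim/tensor_ind: a => [|a b IHa IHb|s l].
- by rewrite !ext_act0l; apply: (tensor_map0 _ (restr_map f)).
- rewrite !ext_actDl -IHa -IHb; exact: (tensor_mapD (restr_map f)).
elim/tensor_ind: t => [|t v IHt IHv|s' m].
- rewrite ext_act0r.
  have f0 : ext_map f 0 = 0 by exact: (tensor_map0 _ (restr_map f)).
  by rewrite f0 ext_act0r.
- have fD x y : ext_map f (x + y) = ext_map f x + ext_map f y.
    exact: (tensor_mapD (restr_map f)).
  by rewrite fD !ext_actDr fD IHt IHv.
by rewrite ext_act_tens2 !ext_map_tens ext_act_tens2 linearZ.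
Qed.
HB.instance Definition _ (M N : lmodType L) (f : {linear M -> N}) :=
  GRing.isLinear.Build ext_alg (ext_mod M) (ext_mod N) *:%R (ext_map f)
    (ext_map_linear f).

Lemma ext_map0 (M N : lmodType L) (f : {linear M -> N}) : ext_map f 0 = 0.
Proof. exact: (linear0 (ext_map f)). Qed.

Lemma ext_mapD (M N : lmodType L) (f : {linear M -> N}) t u :
  ext_map f (t + u) = ext_map f t + ext_map f u.
Proof. exact: (linearD (ext_map f)). Qed.

End BaseChange.
Arguments self_mod {R} S.
Arguments ext_mod {R} S {L} M.
Arguments ext_alg {R} S L.
Arguments ext_tens {R S L M} s m.
Arguments ext_map {R} S {L M N} f.

Section Homology.
Variables (A : pzRingType) (U V W : lmodType A).
Variables (f : {linear U -> V}) (g : {linear V -> W}).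

Definition cycle_pred : {pred V} := [pred v | g v == 0].

Fact cycle_submod : subsemimod_closed cycle_pred.
Proof.
split; last by move=> a v; rewrite !inE linearZ => /eqP->; rewrite /= scaler0.
split; first by rewrite inE linear0.
by move=> u v; rewrite !inE linearD => /eqP-> /eqP->; rewrite addr0.
Qed.
HB.instance Definition _ := GRing.isSubmodClosed.Build A V cycle_pred cycle_submod.

Record cycles : Type :=
  Cycles { cycles_val :> V; cyclesP : cycles_val \in cycle_pred }.
HB.instance Definition _ := [isSub for cycles_val].
HB.instance Definition _ := [Choice of cycles by <:].
HB.instance Definition _ := [SubChoice_isSubLmodule of cycles by <:].

Lemma cycles_eq0 (z : cycles) : g (val z) = 0.
Proof. by apply/eqP; case: z. Qed.

Definition boundary_pred : {pred cycles} :=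
  [pred z : cycles | `[< exists u, f u = val z >]].

Fact boundary_submod : subsemimod_closed boundary_pred.
Proof.
split; last first.
  move=> a z /asboolP[u uz]; apply/asboolP; exists (a *: u).
  by rewrite [LHS]linearZ /= uz.
split; first by apply/asboolP; exists 0; rewrite !linear0.
move=> z z' /asboolP[u uz] /asboolP[u' uz']; apply/asboolP; exists (u + u').
by rewrite [LHS]linearD uz uz'.
Qed.
HB.instance Definition _ :=
  GRing.isSubmodClosed.Build A cycles boundary_pred boundary_submod.

(* ker g / (im f :&: ker g); in a complex, ker g / im f *)
Definition homology : Type := Quotient.quot boundary_pred.
HB.instance Definition _ := GRing.Zmodule.on homology.
HB.instance Definition _ := EqQuotient.on homology.

Lemma homology_piP z z' :
  \pi_homology z = \pi_homology z' <-> exists u, f u = val z - val z'.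
Proof.
have -> : \pi_homology z = \pi_homology z' <-> z - z' \in boundary_pred.
  by rewrite Quotient.idealrBE; split=> [->|/eqP].
by split=> [/asboolP[u uE]|[u uE]]; [|apply/asboolP]; exists u; rewrite uE raddfB.
Qed.

Definition homology_scale (a : A) (c : homology) : homology :=
  \pi_homology (a *: repr c).

Lemma homology_scale_pi a z :
  homology_scale a (\pi_homology z) = \pi_homology (a *: z).
Proof.
apply/homology_piP; have /homology_piP[u uE] := reprK (\pi_homology z).
by exists (a *: u); rewrite [LHS]linearZ /= uE scalerBr !linearZ.
Qed.

Lemma homology_piD z z' :
  \pi_homology (z + z') = \pi_homology z + \pi_homology z'.
Proof. exact: (Quotient.pi_add boundary_pred). Qed.

Lemma homologyW (c : homology) : exists z, c = \pi_homology z.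
Proof. by exists (repr c); rewrite reprK. Qed.

Fact homology_scaleA a b c :
  homology_scale a (homology_scale b c) = homology_scale (a * b) c.
Proof. by have [z ->] := homologyW c; rewrite !homology_scale_pi scalerA. Qed.
Fact homology_scale1 : left_id 1 homology_scale.
Proof. by move=> c; have [z ->] := homologyW c; rewrite homology_scale_pi scale1r. Qed.
Fact homology_scaleDr : right_distributive homology_scale +%R.
Proof.
move=> a c c'; have [z ->] := homologyW c; have [z' ->] := homologyW c'.
by rewrite -homology_piD !homology_scale_pi scalerDr homology_piD.
Qed.
Fact homology_scaleDl c : {morph homology_scale^~ c : a b / a + b}.
Proof.
move=> a b; have [z ->] := homologyW c.
by rewrite !homology_scale_pi scalerDl homology_piD.
Qed.
HB.instance Definition _ := GRing.Zmodule_isLmodule.Build A homology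
  homology_scaleA homology_scale1 homology_scaleDr homology_scaleDl.

Lemma homology_pi_linear a z z' :
  a *: (\pi_homology z : homology) + \pi_homology z' = \pi_homology (a *: z + z').
Proof. by rewrite homology_piD; congr (_ + _); apply: homology_scale_pi. Qed.

End Homology.
Arguments homologyW {A U V W f g} c.

Section Complexes.
Variable A : pzRingType.

Definition finitely_generated (M : lmodType A) : Prop :=
  exists (n : nat) (e : 'I_n -> M),
    forall m, exists c : 'I_n -> A, m = \sum_i c i *: e i.

(* Unbounded cochain complexes. To avoid transporting along i - 1 + 1 = i,
   degreewise conditions are stated in degree i + 1, for every i. *)
Record complex : Type := Complex {
  term :> int -> lmodType A;
  diff : forall i, {linear term i -> term (i + 1)};
  diffK : forall i x, diff (i + 1) (diff i x) = 0;
  term_fg : forall i, finitely_generated (term i)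
}.

Record chain_map (X Y : complex) : Type := ChainMap {
  chain :> forall i, {linear X i -> Y i};
  chain_diff : forall i x, chain (i + 1) (diff X i x) = diff Y i (chain i x)
}.

Definition homotopic (X Y : complex) (f g : chain_map X Y) : Prop :=
  exists h : forall i, {linear X (i + 1) -> Y i}, forall i x,
    f (i + 1) x - g (i + 1) x = diff Y i (h i x) + h (i + 1) (diff X (i + 1) x).

(* H^(i + 1) *)
Definition coh (X : complex) (i : int) : lmodType A :=
  homology (diff X i) (diff X (i + 1)).

Section InducedMap.
Variables (X Y : complex) (f : chain_map X Y) (i : int).

Fact chain_cycle (z : cycles (diff X (i + 1))) :
  f (i + 1) (val z) \in cycle_pred (diff Y (i + 1)).
Proof. by rewrite inE -chain_diff cycles_eq0 linear0. Qed.

Definition coh_map (c : coh X i) : coh Y i :=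
  \pi_(homology (diff Y i) (diff Y (i + 1))) (Cycles (chain_cycle (repr c))).

Lemma coh_map_pi z :
  coh_map (\pi_(homology (diff X i) (diff X (i + 1))) z) =
  \pi_(homology (diff Y i) (diff Y (i + 1))) (Cycles (chain_cycle z)).
Proof.
apply/homology_piP => /=.
have /homology_piP[u uE] := reprK (\pi_(homology (diff X i) (diff X (i + 1))) z).
by exists (f i u); rewrite -chain_diff uE linearB.
Qed.

Fact coh_map_linear : linear coh_map.
Proof.
move=> a c c'; have [z ->] := homologyW c; have [z' ->] := homologyW c'.
rewrite [X in coh_map X]homology_pi_linear !coh_map_pi [RHS]homology_pi_linear.
by congr \pi_(homology _ _); apply: val_inj; rewrite [LHS]linearD linearZ.
Qed.
HB.instance Definition _ :=
  GRing.isLinear.Build A (coh X i) (coh Y i) *:%R coh_map coh_map_linear.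

End InducedMap.

Definition quasi_iso (X Y : complex) (f : chain_map X Y) : Prop :=
  forall i, bijective (coh_map f (i := i)).

End Complexes.

(* Categories whose hom-sets are setoids: heq is equality of morphisms. *)
Record category : Type := Category {
  obj :> Type;
  mor : obj -> obj -> Type;
  heq : forall X Y, mor X Y -> mor X Y -> Prop;
  idm : forall X, mor X X;
  hcomp : forall X Y Z, mor Y Z -> mor X Y -> mor X Z;
  heq_refl : forall X Y (f : mor X Y), heq f f;
  heq_sym : forall X Y (f g : mor X Y), heq f g -> heq g f;
  heq_trans : forall X Y (f g h : mor X Y), heq f g -> heq g h -> heq f h;
  heq_comp : forall X Y Z (g g' : mor Y Z) (f f' : mor X Y),
    heq g g' -> heq f f' -> heq (hcomp g f) (hcomp g' f');
  hcompA : forall X Y Z T (h : mor Z T) (g : mor Y Z) (f : mor X Y),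
    heq (hcomp h (hcomp g f)) (hcomp (hcomp h g) f);
  hcomp1l : forall X Y (f : mor X Y), heq (hcomp (idm Y) f) f;
  hcomp1r : forall X Y (f : mor X Y), heq (hcomp f (idm X)) f
}.
Arguments mor {c} X Y.
Arguments heq {c X Y} f g.
Arguments idm {c} X.
Arguments hcomp {c X Y Z} g f.

Definition is_iso (C : category) (X Y : C) (f : mor X Y) : Prop :=
  exists g : mor Y X, heq (hcomp g f) (idm X) /\ heq (hcomp f g) (idm Y).

Record functor (C D : category) : Type := Functor {
  fobj :> C -> D;
  fmap : forall X Y, mor X Y -> mor (fobj X) (fobj Y);
  fmap_heq : forall X Y (f g : mor X Y), heq f g -> heq (fmap f) (fmap g);
  fmap1 : forall X, heq (fmap (idm X)) (idm (fobj X));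
  fmap_comp : forall X Y Z (g : mor Y Z) (f : mor X Y),
    heq (fmap (hcomp g f)) (hcomp (fmap g) (fmap f))
}.
Arguments fmap {C D} F {X Y} f : rename.

Section Localisation.
Variables (C : category) (W : forall X Y : C, mor X Y -> Prop).

(* The localisation C[W^-1] by generators and relations (Gabriel-Zisman). *)
Inductive loc_hom : C -> C -> Type :=
| loc_fwd X Y : mor X Y -> loc_hom X Y
| loc_inv X Y (w : mor X Y) : W w -> loc_hom Y X
| loc_comp X Y Z : loc_hom Y Z -> loc_hom X Y -> loc_hom X Z.

Inductive loc_heq : forall X Y, loc_hom X Y -> loc_hom X Y -> Prop :=
| loc_refl X Y (a : loc_hom X Y) : loc_heq a a
| loc_sym X Y (a b : loc_hom X Y) : loc_heq a b -> loc_heq b a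
| loc_trans X Y (a b c : loc_hom X Y) :
    loc_heq a b -> loc_heq b c -> loc_heq a c
| loc_comp_heq X Y Z (b b' : loc_hom Y Z) (a a' : loc_hom X Y) :
    loc_heq b b' -> loc_heq a a' -> loc_heq (loc_comp b a) (loc_comp b' a')
| loc_compA X Y Z T (c : loc_hom Z T) (b : loc_hom Y Z) (a : loc_hom X Y) :
    loc_heq (loc_comp c (loc_comp b a)) (loc_comp (loc_comp c b) a)
| loc_comp1l X Y (a : loc_hom X Y) :
    loc_heq (loc_comp (loc_fwd (idm Y)) a) a
| loc_comp1r X Y (a : loc_hom X Y) :
    loc_heq (loc_comp a (loc_fwd (idm X))) a
| loc_fwd_heq X Y (f g : mor X Y) :
    heq f g -> loc_heq (loc_fwd f) (loc_fwd g)
| loc_fwd_comp X Y Z (g : mor Y Z) (f : mor X Y) :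
    loc_heq (loc_fwd (hcomp g f)) (loc_comp (loc_fwd g) (loc_fwd f))
| loc_invl X Y (w : mor X Y) (Ww : W w) :
    loc_heq (loc_comp (loc_inv Ww) (loc_fwd w)) (loc_fwd (idm X))
| loc_invr X Y (w : mor X Y) (Ww : W w) :
    loc_heq (loc_comp (loc_fwd w) (loc_inv Ww)) (loc_fwd (idm Y)).

Definition localisation : category :=
  @Category C loc_hom loc_heq (fun X => loc_fwd (idm X)) loc_comp
    loc_refl loc_sym loc_trans loc_comp_heq loc_compA loc_comp1l loc_comp1r.

Definition loc_functor : functor C localisation :=
  @Functor C localisation id loc_fwd loc_fwd_heq
    (fun X => loc_refl (loc_fwd (idm X))) loc_fwd_comp.

End Localisation.

Section LocalisationMap.
Variables (C D : category).
Variables (W : forall X Y : C, mor X Y -> Prop).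
Variables (W' : forall X Y : D, mor X Y -> Prop).
Variables (F : functor C D).
Variable FW : forall X Y (f : mor X Y), W f -> W' (fmap F f).

Fixpoint loc_fmap X Y (a : loc_hom W X Y) : loc_hom W' (F X) (F Y) :=
  match a with
  | loc_fwd _ _ f => loc_fwd W' (fmap F f)
  | loc_inv _ _ _ Ww => loc_inv (FW Ww)
  | loc_comp _ _ _ b a => loc_comp (loc_fmap b) (loc_fmap a)
  end.

Fact loc_fmap1 X :
  loc_heq (loc_fwd W' (fmap F (idm X))) (loc_fwd W' (idm (F X))).
Proof. by apply: loc_fwd_heq; apply: fmap1. Qed.

Fact loc_fmap_heq X Y (a b : loc_hom W X Y) :
  loc_heq a b -> loc_heq (loc_fmap a) (loc_fmap b).
Proof.
elim=> {X Y a b} /=.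
- by move=> *; apply: loc_refl.
- by move=> X Y a b _; apply: loc_sym.
- by move=> X Y a b c _ + _; apply: loc_trans.
- by move=> X Y Z b b' a a' _ + _; apply: loc_comp_heq.
- by move=> *; apply: loc_compA.
- move=> X Y a; apply: loc_trans (loc_comp1l _).
  by apply: loc_comp_heq; [apply: loc_fmap1|apply: loc_refl].
- move=> X Y a; apply: loc_trans (loc_comp1r _).
  by apply: loc_comp_heq; [apply: loc_refl|apply: loc_fmap1].
- by move=> X Y f g fg; apply: loc_fwd_heq; apply: fmap_heq.
- move=> X Y Z g f; apply: loc_trans (loc_fwd_comp _ _ _).
  by apply: loc_fwd_heq; apply: fmap_comp.
- by move=> X Y w Ww; apply: loc_trans (loc_sym (loc_fmap1 _)); apply: loc_invl.
- by move=> X Y w Ww; apply: loc_trans (loc_sym (loc_fmap1 _)); apply: loc_invr.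
Qed.

(* The functor C[W^-1] -> D[W'^-1] induced by F. *)
Definition localisation_map : functor (localisation W) (localisation W') :=
  @Functor (localisation W) (localisation W') F loc_fmap loc_fmap_heq loc_fmap1
    (fun X Y Z b a => loc_refl (loc_comp (loc_fmap b) (loc_fmap a))).

End LocalisationMap.

Section HomotopyCategory.
Variable A : pzRingType.

Definition chain_id (X : complex A) : chain_map X X :=
  @ChainMap A X X (fun i => idfun) (fun i x => erefl).

Fact chain_comp_diff (X Y Z : complex A) (g : chain_map Y Z) (f : chain_map X Y)
    i x :
  (g (i + 1) \o f (i + 1)) (diff X i x) = diff Z i ((g i \o f i) x).
Proof. by rewrite /= !chain_diff. Qed.
Definition chain_comp (X Y Z : complex A) (g : chain_map Y Z) (f : chain_map X Y) :
    chain_map X Z :=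
  @ChainMap A X Z (fun i => (g i \o f i)) (chain_comp_diff g f).

Fact homotopic_refl (X Y : complex A) (f : chain_map X Y) : homotopic f f.
Proof. by exists (fun i => \0) => i x; rewrite /= linear0 addr0 subrr. Qed.

Fact homotopic_sym (X Y : complex A) (f g : chain_map X Y) :
  homotopic f g -> homotopic g f.
Proof.
move=> [h hE]; exists (fun i => \- h i) => i x /=.
by rewrite linearN -opprD -hE opprB.
Qed.

Fact homotopic_trans (X Y : complex A) (f g k : chain_map X Y) :
  homotopic f g -> homotopic g k -> homotopic f k.
Proof.
move=> [h hE] [h' hE']; exists (fun i => (h i \+ h' i)) => i x /=.
by rewrite linearD addrACA -hE -hE' addrA subrK.
Qed.

Fact homotopic_comp (X Y Z : complex A) (g g' : chain_map Y Z)
    (f f' : chain_map X Y) :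
  homotopic g g' -> homotopic f f' ->
  homotopic (chain_comp g f) (chain_comp g' f').
Proof.
move=> [k kE] [h hE].
exists (fun i => ((g i \o h i) \+ (k i \o f' (i + 1)))) => i x /=.
rewrite (chain_diff f') linearD addrACA -(chain_diff g) -linearD -hE -kE linearB.
by rewrite addrA subrK.
Qed.

(* K(A), on complexes of finitely generated A-modules *)
Definition homotopy_category : category.
refine (@Category (complex A) (@chain_map A) (@homotopic A) chain_id chain_comp
  homotopic_refl homotopic_sym homotopic_trans homotopic_comp _ _ _);
  by move=> *; exists (fun i => \0) => i x; rewrite /= linear0 addr0 subrr.
Defined.

Definition derived_category : category :=
  localisation (C := homotopy_category) (@quasi_iso A).

End HomotopyCategory.

(* Exactness of the cone of f in degree i + 1, in terms of elements. *)
Definition cone_exact (A : pzRingType) (X Y : complex A) (f : chain_map X Y)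
    (i : int) : Prop :=
  forall (x : X (i + 1 + 1)) (y : Y (i + 1)),
    diff X (i + 1 + 1) x = 0 -> f (i + 1 + 1) x + diff Y (i + 1) y = 0 ->
  exists (x' : X (i + 1)) (y' : Y i),
    - diff X (i + 1) x' = x /\ f (i + 1) x' + diff Y i y' = y.

Section QuasiIso.
Variables (A : pzRingType) (X Y : complex A) (f : chain_map X Y).

Lemma coh_map_injP i : injective (coh_map f (i := i)) <->
  forall x y, diff X (i + 1) x = 0 -> f (i + 1) x = diff Y i y ->
    exists u, diff X i u = x.
Proof.
split=> [inj x y dx fx|h c c'].
  have zx : x \in cycle_pred (diff X (i + 1)) by rewrite inE dx.
  have : coh_map f (\pi_(homology _ _) (Cycles zx)) =
         coh_map f (\pi_(homology _ _) 0).
    by rewrite !coh_map_pi; apply/homology_piP; exists y; rewrite /= linear0 subr0.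
  by move/inj/homology_piP => -[u]; rewrite /= subr0; exists u.
have [z ->] := homologyW c; have [z' ->] := homologyW c'.
rewrite !coh_map_pi => /homology_piP[y /= yE]; apply/homology_piP.
apply: (h _ y); last by rewrite linearB yE.
by rewrite linearB !cycles_eq0 subrr.
Qed.

Lemma coh_map_surjP i : (forall c', exists c, coh_map f (i := i) c = c') <->
  forall y, diff Y (i + 1) y = 0 ->
    exists x v, diff X (i + 1) x = 0 /\ f (i + 1) x + diff Y i v = y.
Proof.
split=> [surj y dy|h c'].
  have zy : y \in cycle_pred (diff Y (i + 1)) by rewrite inE dy.
  have [c] := surj (\pi_(homology _ _) (Cycles zy)).
  have [[x xP] ->] := homologyW c; rewrite coh_map_pi.
  move=> /esym/homology_piP[v /= vE]; exists x, v; split; last by rewrite vE [LHS]addrC subrK.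
  by move: xP; rewrite inE => /eqP.
have [[y yP] ->] := homologyW c'.
have [|x [v [dx xE]]] := h y; first by move: yP; rewrite inE => /eqP.
have zx : x \in cycle_pred (diff X (i + 1)) by rewrite inE dx.
exists (\pi_(homology _ _) (Cycles zx)); rewrite coh_map_pi.
by apply/homology_piP; exists (- v); rewrite /= -xE linearN opprD addrA subrr add0r.
Qed.

Lemma quasi_isoP : quasi_iso f <-> forall i, cone_exact f i.
Proof.
split=> [qf i x y dx fx|h i].
  have [/bij_inj/coh_map_injP inj _] := (qf (i + 1), qf i).
  have [|u du] := inj x (- y) dx; first by rewrite linearN; apply/eqP; rewrite -addr_eq0 fx.
  have /coh_map_surjP surj : forall c', exists c, coh_map f (i := i) c = c'.
    by move=> c'; have [g _ gK] := qf i; exists (g c').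
  have [|z [w [dz zE]]] := surj (y + f (i + 1) u).
    by rewrite linearD -chain_diff du [LHS]addrC.
  exists (z - u), w; rewrite linearB dz sub0r opprK; split=> //.
  by rewrite linearB addrAC zE addrK.
have inj : injective (coh_map f (i := i)).
  apply/coh_map_injP; rewrite -(subrK 1 i) => x y dx fx.
  have [|x' [y' [xE _]]] := h (i - 1) x (- y) dx.
    by rewrite fx linearN subrr.
  by exists (- x'); rewrite linearN.
have /choice[g gK] : forall c', exists c, coh_map f (i := i) c = c'.
  apply/coh_map_surjP => y dy; have [||x' [y' [xE yE]]] := h i 0 y.
  - by rewrite linear0.
  - by rewrite linear0 add0r.
  by exists x', y'; split=> //; apply/eqP; rewrite -oppr_eq0 xE.
by exists g => // c; apply: inj; rewrite gK.
Qed.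

End QuasiIso.

Section BaseChangeComplex.
Variables (R : comPzRingType) (S : comPzAlgType R) (L : pzAlgType R).

Lemma ext_mod_fg (M : lmodType L) :
  finitely_generated M -> finitely_generated (ext_mod S M : lmodType (ext_alg S L)).
Proof.
move=> [n [e eE]]; exists n, (fun i => ext_tens 1 (e i)).
elim/ext_mod_ind => [|t u [c ->] [c' ->]|s m].
- by exists (fun=> 0); rewrite big1 // => i _; rewrite scale0r.
- exists (fun i => c i + c' i); rewrite -big_split /=.
  by apply: eq_bigr => i _; rewrite scalerDl.
have [c ->] := eE m; exists (fun i => ext_tens s (c i : L^o)).
transitivity (\sum_i ext_tens s (c i *: e i)).
  elim/big_ind2: _ => //; last by move=> ? x ? y <- <-; rewrite -ext_tensDr.
  by rewrite ext_tens0r.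
by apply: eq_bigr => i _; rewrite [RHS]ext_act_tens2 mulr1.
Qed.

Fact ext_diffK (X : complex L) i (x : ext_mod S (X i)) :
  ext_map S (diff X (i + 1)) (ext_map S (diff X i) x) = 0.
Proof.
elim/ext_mod_ind: x => [|t u IHt IHu|s m].
- by rewrite !ext_map0.
- by rewrite !ext_mapD IHt IHu addr0.
rewrite !ext_map_tens diffK.
exact: ext_tens0r.
Qed.

Definition ext_complex (X : complex L) : complex (ext_alg S L) :=
  @Complex (ext_alg S L) (fun i => ext_mod S (X i))
    (fun i => ext_map S (diff X i)) (@ext_diffK X)
    (fun i => ext_mod_fg (term_fg X i)).

Fact ext_chain_diff (X Y : complex L) (f : chain_map X Y) i x :
  ext_map S (f (i + 1)) (diff (ext_complex X) i x) =
  diff (ext_complex Y) i (ext_map S (f i) x).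
Proof.
rewrite /=; elim/ext_mod_ind: x => [|t u IHt IHu|s m].
- by rewrite !ext_map0.
- by rewrite !ext_mapD IHt IHu.
by rewrite !ext_map_tens chain_diff.
Qed.

Definition ext_chain_map (X Y : complex L) (f : chain_map X Y) :
    chain_map (ext_complex X) (ext_complex Y) :=
  @ChainMap _ (ext_complex X) (ext_complex Y) (fun i => ext_map S (f i))
    (ext_chain_diff f).

Fact ext_homotopic (X Y : complex L) (f g : chain_map X Y) :
  homotopic f g -> homotopic (ext_chain_map f) (ext_chain_map g).
Proof.
move=> [h hE]; exists (fun i => ext_map S (h i)) => i x /=.
elim/ext_mod_ind: x => [|t u IHt IHu|s m].
- by rewrite !ext_map0 subrr addr0.
- by rewrite !ext_mapD opprD addrACA IHt IHu addrACA.
rewrite /= !ext_map_tens -ext_tensDr -hE ext_tensDr; congr (_ + _).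
by apply: (addrI (ext_tens s (g (i + 1) m))); rewrite -ext_tensDr !subrr ext_tens0r.
Qed.

Fact chain_eq_homotopic (A : pzRingType) (X Y : complex A) (f g : chain_map X Y) :
  (forall i x, f i x = g i x) -> homotopic f g.
Proof. by move=> fg; exists (fun i => \0) => i x; rewrite /= linear0 addr0 fg subrr. Qed.

Fact ext_chain_id (X : complex L) :
  homotopic (ext_chain_map (chain_id X)) (chain_id (ext_complex X)).
Proof. by apply: chain_eq_homotopic => i x; apply: (tensor_map_id (f := idfun)). Qed.

Fact ext_chain_comp (X Y Z : complex L) (g : chain_map Y Z) (f : chain_map X Y) :
  homotopic (ext_chain_map (chain_comp g f))
            (chain_comp (ext_chain_map g) (ext_chain_map f)).
Proof.
apply: chain_eq_homotopic => i x.
exact: (tensor_map_comp (f := restr_map (f i)) (g := restr_map (g i))).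
Qed.

(* S (x)_R - : K(L) -> K(S (x)_R L) *)
Definition ext_homotopy : functor (homotopy_category L) (homotopy_category (ext_alg S L)) :=
  @Functor (homotopy_category L) (homotopy_category (ext_alg S L))
    ext_complex ext_chain_map ext_homotopic ext_chain_id ext_chain_comp.

End BaseChangeComplex.

Section Cone.
Variables (R : comPzRingType) (L : pzAlgType R).
Variables (X Y : complex L) (f : chain_map X Y).

Definition cone (i : int) : lmodType R := (restr (X (i + 1)%R) * restr (Y i))%type.

Definition cone_diff (i : int) (p : cone i) : cone (i + 1) :=
  (- diff X (i + 1) p.1, f (i + 1) p.1 + diff Y i p.2).

Fact cone_diff_linear i : linear (@cone_diff i).
Proof.
move=> a [x y] [x' y']; rewrite /cone_diff /=; congr pair.
  rewrite [diff X _ _](linearP (restr_map (diff X (i + 1)))) opprD.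
  by rewrite -scalerN.
rewrite [f _ _](linearP (restr_map (f (i + 1)))).
by rewrite [diff Y _ _](linearP (restr_map (diff Y i))) addrACA -scalerDr.
Qed.
HB.instance Definition _ i :=
  GRing.isLinear.Build R (cone i) (cone (i + 1)) *:%R (@cone_diff i)
    (@cone_diff_linear i).

Lemma cone_exactP i :
  cone_exact f i <-> exact_at (cone_diff (i := i)) (cone_diff (i := i + 1)).
Proof.
split=> [h [x y]|h x y dx fx].
  split=> [[/eqP]|[[x' y'] [<- <-]]].
    rewrite oppr_eq0 => /eqP dx /= fx.
    by have [x' [y' [<- <-]]] := h x y dx fx; exists (x', y').
  rewrite /cone_diff /=; congr pair; first by rewrite linearN diffK !oppr0.
  by rewrite linearN linearD diffK addr0 chain_diff addNr.
have [|[x' y'] [<- <-]] := (h (x, y)).1; last by exists x', y'.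
by rewrite /cone_diff /= dx fx oppr0.
Qed.

End Cone.

Section FlatBaseChange.
Variables (R : comPzRingType) (S : comPzAlgType R) (L : pzAlgType R).
Variables (X Y : complex L) (f : chain_map X Y) (i : int).
Local Notation T := (tensor_map (self_mod S)).

Lemma ext_cone_fst (p : tensor (self_mod S) (cone X Y i)) :
  T fst (T (@cone_diff R L X Y f i) p) = - ext_map S (diff X (i + 1)) (T fst p).
Proof.
elim/tensor_ind: p => [|p q IHp IHq|s [x y]].
- by rewrite !tensor_map0 ext_map0 oppr0.
- by rewrite !tensor_mapD IHp IHq ext_mapD opprD.
- by rewrite !tensor_map_tens tensNr ext_map_tens.
Qed.

Lemma ext_cone_snd (p : tensor (self_mod S) (cone X Y i)) :
  T snd (T (@cone_diff R L X Y f i) p) =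
  ext_map S (f (i + 1)) (T fst p) + ext_map S (diff Y i) (T snd p).
Proof.
elim/tensor_ind: p => [|p q IHp IHq|s [x y]].
- by rewrite !tensor_map0 !ext_map0 addr0.
- by rewrite !tensor_mapD IHp IHq !ext_mapD addrACA.
- by rewrite !tensor_map_tens tensDr !ext_map_tens.
Qed.
End FlatBaseChange.

Lemma ext_quasi_iso (R : comPzRingType) (S : comPzAlgType R) (L : pzAlgType R)
    (X Y : complex L) (f : chain_map X Y) :
  flat (self_mod S) -> quasi_iso f -> quasi_iso (ext_chain_map S f).
Proof.
move=> flS /quasi_isoP qf; apply/quasi_isoP => i x y dx fx.
have /cone_exactP/flS ex := qf i.
have [|q qE] := (ex (tens_pair x y)).1.
  rewrite [LHS]tens_pair_eta ext_cone_fst ext_cone_snd.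
  rewrite tens_pair_fst tens_pair_snd [X in - X]dx oppr0 [X in tens_pair _ X]fx.
  by rewrite /tens_pair !tensor_map0 addr0.
exists (tensor_map _ fst q), (tensor_map _ snd q); split.
  by rewrite -[RHS](tens_pair_fst _ y) -qE ext_cone_fst.
by rewrite -[RHS](tens_pair_snd x) -qE ext_cone_snd.
Qed.

Section DerivedBaseChange.
Variables (R : comPzRingType) (S : comPzAlgType R) (L : pzAlgType R).

(* S (x)^L_R - : D(L) -> D(S (x)_R L), for S flat over R *)
Definition derived_ext (flS : flat (self_mod S)) :
    functor (derived_category L) (derived_category (ext_alg S L)) :=
  localisation_map (F := ext_homotopy S L)
    (fun X Y f => @ext_quasi_iso R S L X Y f flS).

End DerivedBaseChange.
Arguments derived_ext {R} S L flS.

(* Main.v *)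
Require Import Defs.
From HB Require Import structures.
From mathcomp Require Import all_boot all_algebra.
From mathcomp Require Import boolp.

(** Quasi-isomorphisms satisfy the left Ore condition, witnessed by the homotopy
    pushout, which again has finitely generated terms. So alpha is a left
    fraction s^-1 f with s a quasi-isomorphism. Cohomology factors through the
    derived category, so if the base change of alpha is an isomorphism then so
    is the map that the base change of f induces on cohomology. The cone of f is
    therefore acyclic after base change, hence acyclic by faithful flatness, so
    f is a quasi-isomorphism and alpha is invertible. *)

Set Implicit Arguments.
Unset Strict Implicit.
Unset Printing Implicit Defensive.

Import GRing.Theory.
Local Open Scope ring_scope.
Local Open Scope quotient_scope.

(** * Left fractions in a localisation *)

Section LeftFractions.
Variables (C : category) (W : forall X Y : C, mor X Y -> Prop).
Hypothesis W1 : forall X : C, W (idm X).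
Hypothesis W_comp : forall (X Y Z : C) (g : mor Y Z) (f : mor X Y),
  W g -> W f -> W (hcomp g f).
Hypothesis W_ore : forall (X Y Z : C) (g : mor Y X) (s : mor Y Z), W s ->
  exists (P : C) (s' : mor X P) (g' : mor Z P),
    W s' /\ heq (hcomp s' g) (hcomp g' s).

(** Insert [s'^-1 s'] on the left of [g s^-1], replace [s' g] by [g' s], and cancel [s s^-1]. *)
Lemma loc_heq_ore (X Y Z P : C) (g : mor Y X) (s : mor Y Z) (s' : mor X P)
    (g' : mor Z P) (Ws : W s) (Ws' : W s') :
  heq (hcomp s' g) (hcomp g' s) ->
  loc_heq (loc_comp (loc_fwd W g) (loc_inv Ws))
          (loc_comp (loc_inv Ws') (loc_fwd W g')).
Proof.
move=> sg; apply: loc_trans (loc_sym (loc_comp1l _)) _.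
apply: loc_trans (loc_comp_heq (loc_sym (loc_invl Ws')) (loc_refl _)) _.
apply: loc_trans (loc_sym (loc_compA _ _ _)) _.
apply: loc_comp_heq (loc_refl _) _; apply: loc_trans (loc_compA _ _ _) _.
apply: (@loc_trans _ _ _ _ _
  (loc_comp (loc_comp (loc_fwd W g') (loc_fwd W s)) (loc_inv Ws))).
  apply: loc_comp_heq (loc_refl _); apply: loc_trans (loc_fwd_comp _ _ _).
  exact: loc_trans (loc_sym (loc_fwd_comp _ _ _)) (loc_fwd_heq _ sg).
apply: loc_trans (loc_sym (loc_compA _ _ _)) _.
exact: loc_trans (loc_comp_heq (loc_refl _) (loc_invr Ws)) (loc_comp1r _).
Qed.

(** Insert [(t s)(t s)^-1] on the right; then [s^-1 t^-1 t s] collapses to the identity. *)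
Lemma loc_inv_comp (X Y Z : C) (t : mor Y Z) (s : mor X Y) (Wt : W t) (Ws : W s)
    (Wts : W (hcomp t s)) :
  loc_heq (loc_comp (loc_inv Ws) (loc_inv Wt)) (loc_inv Wts).
Proof.
apply: loc_trans (loc_sym (loc_comp1r _)) _.
apply: loc_trans (loc_comp_heq (loc_refl _) (loc_sym (loc_invr Wts))) _.
apply: loc_trans (loc_compA _ _ _) _.
apply: loc_trans (loc_comp1l _); apply: loc_comp_heq (loc_refl _).
apply: loc_trans (loc_comp_heq (loc_refl _) (loc_fwd_comp _ _ _)) _.
apply: loc_trans (loc_sym (loc_compA _ _ _)) _.
apply: loc_trans (loc_invl Ws); apply: loc_comp_heq (loc_refl _) _.
apply: loc_trans (loc_compA _ _ _) _.
exact: loc_trans (loc_comp_heq (loc_invl Wt) (loc_refl _)) (loc_comp1l _).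
Qed.

(** Induction on the word. A generator [f] is [id^-1 f], and a formal inverse is [w^-1 id]. In a
    composite [t^-1 g s^-1 f] the Ore square turns the middle [g s^-1] into [s'^-1 g'], which leaves
    [(s' t)^-1 (g' f)]. *)
Lemma loc_left_fraction (X Y : C) (a : loc_hom W X Y) :
  exists (P : C) (f : mor X P) (s : mor Y P) (Ws : W s),
    loc_heq a (loc_comp (loc_inv Ws) (loc_fwd W f)).
Proof.
elim: {X Y} a => [X Y f|X Y w Ww|X Y Z b [P [g [t [Wt bE]]]] a [Q [f [s [Ws aE]]]]].
- exists Y, f, (idm Y), (W1 Y); apply: loc_sym.
  apply: loc_trans (loc_comp1l _); apply: loc_comp_heq (loc_refl _).
  by apply: loc_trans (loc_sym (loc_comp1r _)) _; apply: loc_invl.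
- by exists Y, (idm Y), w, Ww; apply/loc_sym/loc_comp1r.
have [T [s' [g' [Ws' sg]]]] := W_ore g Ws.
exists T, (hcomp g' f), (hcomp s' t), (W_comp Ws' Wt).
apply: loc_trans (loc_comp_heq bE aE) _.
apply: loc_trans (loc_sym (loc_compA _ _ _)) _.
apply: loc_trans (loc_comp_heq (loc_refl _) (loc_compA _ _ _)) _.
apply: loc_trans (loc_comp_heq (loc_refl _)
  (loc_comp_heq (loc_heq_ore Ws Ws' sg) (loc_refl _))) _.
apply: loc_trans (loc_comp_heq (loc_refl _) (loc_sym (loc_compA _ _ _))) _.
apply: loc_trans (loc_compA _ _ _) _.
exact: loc_comp_heq (loc_inv_comp _ _ _) (loc_sym (loc_fwd_comp _ _ _)).
Qed.

End LeftFractions.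

(** The inverse of [s^-1 f] is [f^-1 s]. *)
Lemma is_iso_fraction (C : category) (W : forall X Y : C, mor X Y -> Prop)
    (X Y P : C) (f : mor X P) (s : mor Y P) (Wf : W X P f) (Ws : W Y P s)
    (a : loc_hom W X Y) :
  loc_heq a (loc_comp (loc_inv Ws) (loc_fwd W f)) ->
  is_iso (C := localisation W) a.
Proof.
move=> aE; exists (loc_comp (loc_inv Wf) (loc_fwd W s)); split=> /=.
  apply: loc_trans (loc_comp_heq (loc_refl _) aE) _.
  apply: loc_trans (loc_sym (loc_compA _ _ _)) _.
  apply: loc_trans (loc_invl Wf); apply: loc_comp_heq (loc_refl _) _.
  apply: loc_trans (loc_compA _ _ _) _.
  exact: loc_trans (loc_comp_heq (loc_invr Ws) (loc_refl _)) (loc_comp1l _).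
apply: loc_trans (loc_comp_heq aE (loc_refl _)) _.
apply: loc_trans (loc_sym (loc_compA _ _ _)) _.
apply: loc_trans (loc_invl Ws); apply: loc_comp_heq (loc_refl _) _.
apply: loc_trans (loc_compA _ _ _) _.
exact: loc_trans (loc_comp_heq (loc_invr Wf) (loc_refl _)) (loc_comp1l _).
Qed.

(** * Cohomology as an invariant of morphisms in the derived category *)

Section Cohomology.
Variable A : pzRingType.

Lemma coh_map_homotopic (X Y : complex A) (f g : chain_map X Y) i :
  homotopic f g -> coh_map f (i := i) =1 coh_map g (i := i).
Proof.
move=> [h hE] c; have [z ->] := homologyW c; rewrite !coh_map_pi.
apply/homology_piP; exists (h i (val z)) => /=.
by rewrite hE cycles_eq0 linear0 addr0.
Qed.

Lemma coh_map_id (X : complex A) i : coh_map (chain_id X) (i := i) =1 id.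
Proof.
move=> c; have [z ->] := homologyW c; rewrite coh_map_pi.
by apply/homology_piP; exists 0; rewrite /= linear0 subrr.
Qed.

Lemma coh_map_comp (X Y Z : complex A) (g : chain_map Y Z) (f : chain_map X Y) i :
  coh_map (chain_comp g f) (i := i) =1 coh_map g (i := i) \o coh_map f (i := i).
Proof.
move=> c; have [z ->] := homologyW c; rewrite /= [coh_map f _]coh_map_pi !coh_map_pi.
by apply/homology_piP; exists 0; rewrite /= linear0 subrr.
Qed.

Lemma quasi_iso_id (X : complex A) : quasi_iso (chain_id X).
Proof. by move=> i; exists id => c; rewrite coh_map_id. Qed.

Lemma quasi_iso_comp (X Y Z : complex A) (g : chain_map Y Z) (f : chain_map X Y) :
  quasi_iso g -> quasi_iso f -> quasi_iso (chain_comp g f).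
Proof.
move=> qg qf i; apply: (eq_bij (bij_comp (qg i) (qf i))) => c.
by rewrite coh_map_comp.
Qed.

(** [bijective] lives in [Prop], so the inverse is repackaged as an existential and extracted by the
    choice principle [cid]. *)
Definition coh_inv (X Y : complex A) (w : chain_map X Y) (Ww : quasi_iso w) i :
    coh Y i -> coh X i :=
  let: exist g _ := cid (let: Bijective g gK Kg := Ww i in
    ex_intro (fun g => cancel _ g /\ cancel g _) g (conj gK Kg)) in g.

Lemma coh_mapK (X Y : complex A) (w : chain_map X Y) (Ww : quasi_iso w) i :
  cancel (coh_map w (i := i)) (coh_inv Ww (i := i)).
Proof. by rewrite /coh_inv; case: cid => g []. Qed.

Lemma coh_invK (X Y : complex A) (w : chain_map X Y) (Ww : quasi_iso w) i :
  cancel (coh_inv Ww (i := i)) (coh_map w (i := i)).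
Proof. by rewrite /coh_inv; case: cid => g []. Qed.

(** The extension of H^(i+1) to the localisation, defined on words; formal inverses act by the
    inverse bijections. *)
Fixpoint coh_loc i (X Y : homotopy_category A)
    (a : loc_hom (C := homotopy_category A) (@quasi_iso A) X Y) :
    coh X i -> coh Y i :=
  match a with
  | loc_fwd X Y f => @coh_map A X Y f i
  | loc_inv X Y w Ww => @coh_inv X Y w Ww i
  | loc_comp X Y Z b a => coh_loc b \o coh_loc a
  end.
Arguments coh_loc i {X Y} a.

(** Each generating relation of the localisation holds in cohomology: functoriality and homotopy
    invariance handle the forward arrows, and the choice of [coh_inv] the two cancellation rules. *)
Lemma coh_loc_heq i (X Y : homotopy_category A)
    (a b : loc_hom (C := homotopy_category A) (@quasi_iso A) X Y) :
  loc_heq a b -> coh_loc i a =1 coh_loc i b.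
Proof.
elim=> {X Y a b} //=.
- by move=> X Y a b _ ab c; rewrite ab.
- by move=> X Y a b c _ ab _ bc x; rewrite ab.
- by move=> X Y Z b b' a a' _ bb' _ aa' x /=; rewrite aa' bb'.
- by move=> X Y a c /=; apply: coh_map_id.
- by move=> X Y a c /=; congr coh_loc; apply: coh_map_id.
- by move=> X Y f g; apply: coh_map_homotopic.
- by move=> X Y Z g f; apply: coh_map_comp.
- by move=> X Y w Ww c /=; rewrite coh_mapK; apply/esym/coh_map_id.
- by move=> X Y w Ww c /=; rewrite coh_invK; apply/esym/coh_map_id.
Qed.

Lemma is_iso_coh_loc i (X Y : derived_category A) (a : mor X Y) :
  is_iso a -> bijective (coh_loc i a).
Proof.
move=> [b [ba ab]]; exists (coh_loc i b) => c.
- by have := coh_loc_heq ba c; rewrite /= => ->; apply: coh_map_id.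
- by have := coh_loc_heq ab c; rewrite /= => ->; apply: coh_map_id.
Qed.

End Cohomology.

(** * Homotopy pushouts and the left Ore condition *)

Lemma finitely_generated_prod (A : pzRingType) (M N : lmodType A) :
  finitely_generated M -> finitely_generated N ->
  finitely_generated (M * N : lmodType A)%type.
Proof.
move=> [m [e eE]] [n [e' eE']].
exists (m + n)%N, (fun k => match split k with
  | inl i => (e i, 0) | inr j => (0, e' j) end) => -[x y].
have [c ->] := eE x; have [c' ->] := eE' y.
exists (fun k => match split k with inl i => c i | inr j => c' j end).
rewrite big_split_ord.
rewrite (eq_bigr (fun i => c i *: (e i, 0 : N))) => [|i _]; last first.
  by rewrite (unsplitK (inl _)).
rewrite (eq_bigr (fun i => c' i *: (0 : M, e' i))) => [|i _]; last first.
  by rewrite (unsplitK (inr _)).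
have -> : \sum_i c i *: (e i, 0 : N) = (\sum_i c i *: e i, 0).
  elim/big_rec2: _ => [//|i u v _ ->].
  by congr pair; rewrite /= scaler0 addr0.
have -> : \sum_i c' i *: (0 : M, e' i) = (0, \sum_i c' i *: e' i).
  elim/big_rec2: _ => [//|i u v _ ->].
  by congr pair; rewrite /= scaler0 addr0.
by congr pair; rewrite /= (addr0, add0r).
Qed.

Section HomotopyPushout.
Variables (A : pzRingType) (X Y Z : complex A).
Variables (g : chain_map Y X) (s : chain_map Y Z).

(** The mapping cone of [(g, - s)] from [Y] to the direct sum of [X] and [Z]. *)
Definition hpo (i : int) : lmodType A := (X i * Z i * Y (i + 1)%R)%type.

Definition hpo_diff i (p : hpo i) : hpo (i + 1) :=
  (diff X i p.1.1 + g (i + 1) p.2, diff Z i p.1.2 - s (i + 1) p.2,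
   - diff Y (i + 1) p.2).

Fact hpo_diff_linear i : linear (@hpo_diff i).
Proof.
move=> a [[x z] y] [[x' z'] y']; rewrite /hpo_diff /=.
by congr (_, _, _); rewrite !linearP //= addrACA -scalerDr.
Qed.
HB.instance Definition _ i :=
  GRing.isLinear.Build A (hpo i) (hpo (i + 1)) *:%R (@hpo_diff i)
    (@hpo_diff_linear i).

Fact hpo_diffK i (p : hpo i) : hpo_diff (hpo_diff p) = 0.
Proof.
case: p => [[x z] y]; rewrite /hpo_diff /=; congr (_, _, _).
- by rewrite linearD linearN diffK add0r chain_diff subrr.
- by rewrite linearB !linearN diffK sub0r opprK chain_diff addNr.
- by rewrite linearN diffK !oppr0.
Qed.

Definition hpo_complex : complex A :=
  @Complex A hpo (fun i => @hpo_diff i) hpo_diffK (fun i =>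
    finitely_generated_prod
      (finitely_generated_prod (term_fg X i) (term_fg Z i)) (term_fg Y (i + 1))).

Definition hpo_inl i (x : X i) : hpo i := (x, 0, 0).
Definition hpo_inr i (z : Z i) : hpo i := (0, z, 0).
(** The homotopy that makes the square commute in the homotopy category. *)
Definition hpo_h i (y : Y (i + 1)) : hpo i := (0, 0, y).

Fact hpo_inl_linear i : linear (@hpo_inl i).
Proof. by move=> a x x'; congr (_, _, _); rewrite /= scaler0 addr0. Qed.
HB.instance Definition _ i :=
  GRing.isLinear.Build A (X i) (hpo i) *:%R (@hpo_inl i) (@hpo_inl_linear i).
Fact hpo_inr_linear i : linear (@hpo_inr i).
Proof. by move=> a z z'; congr (_, _, _); rewrite /= scaler0 addr0. Qed.
HB.instance Definition _ i :=
  GRing.isLinear.Build A (Z i) (hpo i) *:%R (@hpo_inr i) (@hpo_inr_linear i).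
Fact hpo_h_linear i : linear (@hpo_h i).
Proof. by move=> a y y'; congr (_, _, _); rewrite /= scaler0 addr0. Qed.
HB.instance Definition _ i :=
  GRing.isLinear.Build A (Y (i + 1)) (hpo i) *:%R (@hpo_h i) (@hpo_h_linear i).

Fact hpo_inl_diff i x :
  hpo_inl (diff X i x) = diff hpo_complex i (hpo_inl x).
Proof. by congr (_, _, _); rewrite /= !linear0 ?(addr0, oppr0). Qed.
Definition hpo_inl_chain : chain_map X hpo_complex :=
  @ChainMap A X hpo_complex (fun i => @hpo_inl i) hpo_inl_diff.

Fact hpo_inr_diff i z :
  hpo_inr (diff Z i z) = diff hpo_complex i (hpo_inr z).
Proof. by congr (_, _, _); rewrite /= !linear0 ?(addr0, oppr0). Qed.
Definition hpo_inr_chain : chain_map Z hpo_complex :=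
  @ChainMap A Z hpo_complex (fun i => @hpo_inr i) hpo_inr_diff.

Lemma hpo_homotopic :
  homotopic (chain_comp hpo_inl_chain g) (chain_comp hpo_inr_chain s).
Proof.
exists (fun i => @hpo_h i) => i y; congr (_, _, _) => /=.
- by rewrite subr0 linear0 add0r addr0.
- by rewrite linear0 addr0.
- by rewrite subrr addNr.
Qed.

(** The quotient of the pushout by [X] is the cone of [- s], which is acyclic. The proof unfolds
    this into a chase with the injectivity and surjectivity of [s] on cohomology. *)
Lemma hpo_inl_quasi_iso : quasi_iso s -> quasi_iso hpo_inl_chain.
Proof.
move=> qs i.
have injs j : injective (coh_map s (i := j)) by apply: bij_inj.
have inj : injective (coh_map hpo_inl_chain (i := i)).
  apply/coh_map_injP => x [[a b] y] _ [-> /esym/eqP + /esym/eqP].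
  rewrite subr_eq0 oppr_eq0 => /eqP /esym sy /eqP dy.
  (* Here [y] is a cycle with [s y = d b], hence [y = d u]; then [d a + g y = d (a + g u)]. *)
  have [u <-] := (coh_map_injP s i).1 (injs i) y b dy sy.
  by exists (a + g i u); rewrite linearD chain_diff.
have surjs : forall c', exists c, coh_map s (i := i) c = c'.
  by move=> c'; exists (coh_inv qs c'); apply: coh_invK.
have /choice[k kK] : forall c', exists c, coh_map hpo_inl_chain (i := i) c = c'.
  apply/coh_map_surjP => -[[x z] y] [dx /eqP + /eqP].
  rewrite subr_eq0 oppr_eq0 => /eqP dz /eqP dy.
  (* The cycle condition gives [d y = 0] and [s y = d z]. Injectivity one degree up gives [y = d u].
     Then [z - s u] is a cycle, so surjectivity writes it as [s v + d c] with [d v = 0]. *)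
  have [u uE] := (coh_map_injP s (i + 1)).1 (injs (i + 1)) y z dy (esym dz).
  have [|v [c [dv vE]]] := (coh_map_surjP s i).1 surjs (z - s (i + 1) u).
    by rewrite linearB -(chain_diff s) uE dz subrr.
  (* The boundary of [(0, c, - (u + v))] is [(- g (u + v), z, y)], so adding it to the image of
     [x + g (u + v)] gives [(x, z, y)]. *)
  exists (x + g (i + 1) (u + v)), (0, c, - (u + v)); split.
    by rewrite [LHS]linearD -(chain_diff g) linearD uE dv addr0.
  congr (_, _, _) => /=.
  - by rewrite linear0 add0r linearN addrK.
  - by rewrite add0r linearN opprK linearD addrCA [diff Z i c + _]addrC vE addrC subrK.
  - by rewrite linearN opprK linearD uE dv addr0 add0r.
by exists k => // c; apply: inj; rewrite kK.
Qed.

End HomotopyPushout.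

(** * Left fractions in the derived category *)

Lemma derived_left_fraction (A : pzRingType) (X Y : homotopy_category A)
    (a : loc_hom (C := homotopy_category A) (@quasi_iso A) X Y) :
  exists (P : homotopy_category A) (f : mor X P) (s : mor Y P)
    (qs : quasi_iso s), loc_heq a (loc_comp (loc_inv qs) (loc_fwd _ f)).
Proof.
apply: loc_left_fraction.
- exact: quasi_iso_id.
- by move=> *; apply: quasi_iso_comp.
move=> {a}X {}Y Z g s qs.
exists (hpo_complex g s), (hpo_inl_chain g s), (hpo_inr_chain g s).
by split; [apply: hpo_inl_quasi_iso|apply: hpo_homotopic].
Qed.

(** * Reflection of quasi-isomorphisms along faithfully flat base change *)

Lemma cone_diffK (R : comPzRingType) (L : pzAlgType R) (X Y : complex L)
    (f : chain_map X Y) i (p : cone X Y i) : cone_diff f (cone_diff f p) = 0.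
Proof.
rewrite /cone_diff /=; congr pair; first by rewrite linearN diffK !oppr0.
by rewrite linearN linearD diffK addr0 chain_diff addNr.
Qed.

(** Being a quasi-isomorphism is exactness of the cone, a condition on the underlying [R]-modules,
    and faithful flatness reflects it. It remains to match the base change of the cone of [f] with
    the cone of the base change. *)
Lemma ext_quasi_iso_reflect (R : comPzRingType) (S : comPzAlgType R)
    (L : pzAlgType R) (X Y : complex L) (f : chain_map X Y) :
  faithfully_flat (self_mod S) -> quasi_iso (ext_chain_map S f) -> quasi_iso f.
Proof.
move=> ffS /quasi_isoP qf; apply/quasi_isoP => i; apply/cone_exactP/ffS => v.
split=> [dv|[u <-]].
  (* The two components of a cycle of the tensored cone form a cycle of the cone of
     [ext_chain_map S f]. *)
  have [||x' [y' [xE yE]]] := qf i (tensor_map _ fst v) (tensor_map _ snd v).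
  - by apply/eqP; rewrite -oppr_eq0 -(@ext_cone_fst _ S _ _ _ f) dv tensor_map0.
  - by rewrite -[LHS](@ext_cone_snd _ S _ _ _ f) dv tensor_map0.
  exists (tens_pair x' y'); rewrite [LHS]tens_pair_eta [RHS]tens_pair_eta.
  by rewrite ext_cone_fst ext_cone_snd tens_pair_fst tens_pair_snd xE yE.
(* Conversely, boundaries are cycles: the two tensored differentials compose to the tensored square
   of the differential. *)
rewrite -(tensor_map_comp (h := @cone_diff _ _ _ _ f (i + 1) \o @cone_diff _ _ _ _ f i)) //.
by apply: tensor_map_eq0 => p; apply: cone_diffK.
Qed.

(** * Reflection of isomorphisms in the derived category *)

Theorem proposition1 (R : comPzRingType) (L : pzAlgType R) (S : comPzAlgType R)
    (ffS : faithfully_flat (self_mod S)) (X Y : derived_category L)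
    (alpha : mor X Y) :
  is_iso (fmap (derived_ext S L (faithfully_flat_flat ffS)) alpha) ->
  is_iso alpha.
Proof.
move=> iso_ext; have [P [f [s [qs aE]]]] := derived_left_fraction alpha.
suff qf : quasi_iso f by apply: is_iso_fraction aE.
set flS := faithfully_flat_flat ffS in iso_ext *.
apply: (ext_quasi_iso_reflect ffS) => i.
(* After base change, H(alpha) = H(s)^-1 H(f). Hence H(f) = H(s) H(alpha) is a composite of
   bijections, the first because flatness preserves the quasi-isomorphism [s]. *)
have extE := coh_loc_heq (i := i) (fmap_heq (derived_ext S L flS) aE).
apply: (eq_bij (bij_comp (ext_quasi_iso flS qs i) (is_iso_coh_loc i iso_ext))) => c.
by rewrite /= [X in coh_map _ X]extE; apply: (coh_invK (ext_quasi_iso flS qs)).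
Qed.
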